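(* Let $n$ be a positive integer and let $\pi=\pi_1\pi_2\ldots\pi_n$ be a permutation of $\{1,\ldots,n\}$ with inversion table $I(\pi)=(a_1,a_2,\ldots,a_n)$. Then $\pi$ is valleyless if and only if $a_k\in\{0,\,n-k\}$ for every $k=1,2,\ldots,n$.
   Context: The inversion table of a permutation $\pi=\pi_1\ldots\pi_n$ of $\{1,\ldots,n\}$ is $(a_1,\ldots,a_n)$, where $a_k$ is the number of entries of the word $\pi$ that lie to the left of the entry $k$ and are greater than $k$. A sequence $s_1,\ldots,s_n$ is valleyless if for all $1\le i<j<k\le n$ one has $s_j\ge\min\{s_i,s_k\}$. *)

(* Defs.v *)
From mathcomp Require Import all_boot all_fingroup.

Set Implicit Arguments.
Unset Strict Implicit.
Unset Printing Implicit Defensive.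

(* A permutation of {1, ..., n} is p : 'S_n, where the ordinal i : 'I_n stands
   for the position, respectively the entry, i.+1.  So pi_(i+1) = word p i. *)
Definition word (n : nat) (p : 'S_n) (i : 'I_n) : nat := (p i).+1.

(* invtable p k is a_(k+1).  The entry k.+1 is at the position (p^-1)%g k. *)
Definition invtable (n : nat) (p : 'S_n) (k : 'I_n) : nat :=
  #|[set j : 'I_n | (j < (p^-1)%g k) && (k.+1 < word p j)]|.

Definition valleyless (n : nat) (s : 'I_n -> nat) : Prop :=
  forall i j k : 'I_n, i < j -> j < k -> minn (s i) (s k) <= s j.

(* Main.v *)
Require Import Defs.
From mathcomp Require Import all_boot all_fingroup.

Set Implicit Arguments.
Unset Strict Implicit.
Unset Printing Implicit Defensive.

(** A sequence is valleyless exactly when no term has larger terms on both of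
    its sides.  The entry [k] of a permutation has [n - k] larger entries, of
    which [a_k] are on its left: so none is on its left iff [a_k = 0], and none
    is on its right iff [a_k = n - k]. *)

Section GreaterTerms.

Variables (n : nat) (s : 'I_n -> nat).

Definition left_greater (j : 'I_n) : {set 'I_n} :=
  [set i : 'I_n | (i < j) && (s j < s i)].

Definition right_greater (j : 'I_n) : {set 'I_n} :=
  [set k : 'I_n | (j < k) && (s j < s k)].

Lemma valleyless_greaterP :
  valleyless s <->
  (forall j, (left_greater j == set0) || (right_greater j == set0)).
Proof.
split=> [s_valleyless j | one_side i j k lt_ij lt_jk].
  have [-> | [i]] := set_0Vmem (left_greater j); first by rewrite eqxx.
  rewrite inE => /andP[lt_ij lt_sjsi]; apply/orP; right.
  apply/eqP/setP=> k; rewrite !inE; apply/negP=> /andP[lt_jk lt_sjsk].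
  have := s_valleyless i j k lt_ij lt_jk.
  by rewrite leqNgt leq_min lt_sjsi lt_sjsk.
rewrite leqNgt leq_min; apply/negP=> /andP[lt_sjsi lt_sjsk].
case/orP: (one_side j) => /eqP/setP.
  by move/(_ i); rewrite !inE lt_ij lt_sjsi.
by move/(_ k); rewrite !inE lt_jk lt_sjsk.
Qed.

Lemma card_left_right_greater (j : 'I_n) :
  #|left_greater j| + #|right_greater j| = #|[set i | s j < s i]|.
Proof.
rewrite -(cardsID [set i : 'I_n | i < j] [set i | s j < s i]).
congr (_ + _); apply: eq_card => i; rewrite !inE.
  by rewrite andbC.
by rewrite -leqNgt; case: (ltngtP j i) => // /val_inj ->; rewrite ltnn.
Qed.

End GreaterTerms.

Lemma card_ord_gt (n k : nat) : #|[set m : 'I_n | k < m]| = n - k.+1.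
Proof.
rewrite -sum1dep_card -(big_geq_mkord k.+1 n xpredT (fun=> 1)).
by rewrite sum_nat_const_nat muln1.
Qed.

Lemma card_perm_gt (n : nat) (p : 'S_n) (k : nat) :
  #|[set i : 'I_n | k < p i]| = n - k.+1.
Proof.
rewrite -card_ord_gt -(card_preimset [set m : 'I_n | k < m] (@perm_inj _ p)).
by apply: eq_card => i; rewrite !inE.
Qed.

Section InversionTable.

Variables (n : nat) (p : 'S_n).

Lemma invtable_perm (j : 'I_n) :
  invtable p (p j) = #|left_greater (word p) j|.
Proof. by rewrite /invtable permK. Qed.

Lemma invtable_perm_eq0 (j : 'I_n) :
  (invtable p (p j) == 0) = (left_greater (word p) j == set0).
Proof. by rewrite invtable_perm cards_eq0. Qed.

Lemma invtable_perm_eq_max (j : 'I_n) :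
  (invtable p (p j) == n - (p j).+1) = (right_greater (word p) j == set0).
Proof.
have card_greater : #|[set i | word p j < word p i]| = n - (p j).+1.
  exact: card_perm_gt.
rewrite invtable_perm -card_greater -card_left_right_greater.
by rewrite -[eqbLHS]addn0 eqn_add2l eq_sym cards_eq0.
Qed.

End InversionTable.

Theorem theorem2 (n : nat) (n_gt0 : 0 < n) (p : 'S_n) :
  valleyless (word p) <->
  (forall k : 'I_n, invtable p k = 0 \/ invtable p k = n - k.+1).
Proof.
split=> [/valleyless_greaterP one_side k | extremal].
  have := one_side ((p^-1)%g k).
  rewrite -invtable_perm_eq0 -invtable_perm_eq_max permKV.
  by case/orP=> /eqP; [left | right].
apply/valleyless_greaterP=> j.
rewrite -invtable_perm_eq0 -invtable_perm_eq_max.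
by case: (extremal (p j)) => ->; rewrite eqxx ?orbT.
Qed.
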